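(* Let $A\in\mathbb{R}^{n\times n}$, let $S\in\mathbb{R}^{n\times n}$ be symmetric positive semidefinite, and let $T>0$. Let $p$ be the number of zero eigenvalues of $A$, counted with algebraic multiplicity, and put $m=n-p$. Assume that $\lambda+\mu\neq 0$ for all nonzero (complex) eigenvalues $\lambda,\mu$ of $A$. Then: (1) There exists an invertible matrix $U\in\mathbb{R}^{n\times n}$ (which can be chosen orthogonal) such that $$\tilde A:=U^{-1}AU=\begin{bmatrix}\tilde A_{11}&\tilde A_{12}\\ 0&\tilde A_{22}\end{bmatrix},\qquad \tilde A_{11}\in\mathbb{R}^{m\times m},\ \tilde A_{22}\in\mathbb{R}^{p\times p},$$ where all eigenvalues of $\tilde A_{11}$ are nonzero and all eigenvalues of $\tilde A_{22}$ are zero. (2) For any invertible $U\in\mathbb{R}^{n\times n}$ as in (1), define $$\tilde S:=U^{-1}SU^{-\mathsf T}=\begin{bmatrix}\tilde S_{11}&\tilde S_{12}\\ \tilde S_{12}^{\mathsf T}&\tilde S_{22}\end{bmatrix},\qquad \tilde F:=e^{\tilde A T},\qquad \tilde V:=\tilde S-\tilde F\tilde S\tilde F^{\mathsf T}=\begin{bmatrix}\tilde V_{11}&\tilde V_{12}\\ \tilde V_{12}^{\mathsf T}&\tilde V_{22}\end{bmatrix},$$ partitioned conformally with $\tilde A$, and define $$\tilde Q_{22}:=\sum_{i=0}^{p-1}\sum_{j=0}^{p-1}\frac{T^{i+j+1}}{i!\,j!\,(i+j+1)}\,\tilde A_{22}^{\,i}\,\tilde S_{22}\,(\tilde A_{22}^{\,j})^{\mathsf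 T}.$$ Then the Sylvester equation $$\tilde A_{11}\tilde Q_{12}+\tilde Q_{12}\tilde A_{22}^{\mathsf T}=-\tilde V_{12}-\tilde A_{12}\tilde Q_{22}$$ has a unique solution $\tilde Q_{12}\in\mathbb{R}^{m\times p}$; with this $\tilde Q_{12}$, the Lyapunov equation $$\tilde A_{11}\tilde Q_{11}+\tilde Q_{11}\tilde A_{11}^{\mathsf T}=-\tilde V_{11}-\tilde A_{12}\tilde Q_{12}^{\mathsf T}-\tilde Q_{12}\tilde A_{12}^{\mathsf T}$$ has a unique solution $\tilde Q_{11}\in\mathbb{R}^{m\times m}$; and $$U\tilde F U^{-1}=e^{AT},\qquad U\begin{bmatrix}\tilde Q_{11}&\tilde Q_{12}\\ \tilde Q_{12}^{\mathsf T}&\tilde Q_{22}\end{bmatrix}U^{\mathsf T}=\int_0^{T}e^{A\tau}\,S\,e^{A^{\mathsf T}\tau}\,d\tau .$$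
   Context: $e^{M}$ denotes the matrix exponential, $M^{\mathsf T}$ the transpose, and $M^{-\mathsf T}=(M^{-1})^{\mathsf T}$. Matrix integrals are entrywise. The convention $M^0=I$ is used. If $p=0$ or $m=0$, the corresponding blocks and equations are empty and are omitted. *)

(* Defs.v *)
From mathcomp Require Import all_boot all_order all_algebra.
From mathcomp Require Import all_classical all_reals all_analysis.
From mathcomp.real_closed Require Export complex.

Set Implicit Arguments.
Unset Strict Implicit.
Unset Printing Implicit Defensive.
Import Order.TTheory GRing.Theory Num.Theory.
Import numFieldNormedType.Exports.

Local Open Scope classical_set_scope.
Local Open Scope ring_scope.

(* The limit is taken in the entrywise topology of 'M[R]_n; the ring structure
   of 'M[R]_n exists for every n, and M ^+ 0 = 1%:M. *)
Definition expmx (R : realType) (n : nat) (M : 'M[R]_n) : 'M[R]_n :=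
  limn (series (fun k : nat => (k`!%:R)^-1 *: (M ^+ k))).

Definition integral_mx (R : realType) (m n : nat) (a b : R)
    (f : R -> 'M[R]_(m, n)) : 'M[R]_(m, n) :=
  \matrix_(i, j) Rintegral (@lebesgue_measure R) `[a, b] (fun t => f t i j).

Definition sym_psd (R : realType) (n : nat) (S : 'M[R]_n) : Prop :=
  S^T = S /\ forall x : 'cV[R]_n, 0 <= (x^T *m S *m x) 0 0.

Definition complex_eigenvalue (R : realType) (n : nat) (A : 'M[R]_n)
    (z : R[i]) : Prop :=
  eigenvalue (map_mx (fun x : R => x%:C%C) A) z.

Definition alg_mult (F : fieldType) (n : nat) (A : 'M[F]_n) (a : F) : nat :=
  mup a (char_poly A).

Lemma alg_mult_le (F : fieldType) (n : nat) (A : 'M[F]_n) (a : F) :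
  (alg_mult A a <= n)%N.
Proof.
have nz : char_poly A != 0 by rewrite monic_neq0 // char_poly_monic.
rewrite /alg_mult mup_leq //; apply/negP => /(dvdp_leq nz).
by rewrite size_exp_XsubC size_char_poly ltnn.
Qed.

Lemma split_dim (F : fieldType) (n p m : nat) (A : 'M[F]_n) (a : F) :
  p = alg_mult A a -> m = (n - p)%N -> (m + p = n)%N.
Proof. by move=> -> ->; rewrite subnK // alg_mult_le. Qed.

(* Conversions between an n x n matrix and its 2 x 2 block partition along
   n = m + p. *)
Definition to_blocks (R : Type) (n m p : nat) (e : (m + p)%N = n)
    (M : 'M[R]_n) : 'M[R]_(m + p) := castmx (esym e, esym e) M.

Definition of_blocks (R : Type) (n m p : nat) (e : (m + p)%N = n)
    (M : 'M[R]_(m + p)) : 'M[R]_n := castmx (e, e) M.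

Definition zero_splitting (R : realType) (n m p : nat) (e : (m + p)%N = n)
    (A U : 'M[R]_n) : Prop :=
  let At := to_blocks e (invmx U *m A *m U) in
  [/\ U \in unitmx,
      dlsubmx At = 0,
      (forall z : R[i], complex_eigenvalue (ulsubmx At) z -> z != 0) &
      (forall z : R[i], complex_eigenvalue (drsubmx At) z -> z = 0)].

(* Main.v *)
(** The Gramian [Q = \int_0^T e^{tA} S e^{tA^T} dt] satisfies [A Q + Q A^T = e^{TA} S e^{TA^T} - S],
    since the right-hand side is the integral of the derivative of the integrand. In block triangular
    coordinates the (2,2) block of [Q] is the Gramian of the nilpotent block [A22], whose exponential is
    a polynomial, and the (1,2) and (1,1) blocks of the equation are the Sylvester and Lyapunov
    equations. Each of these has a unique solution because [A11] shares no complex eigenvalue with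
    [- A22^T] or [- A11^T]: if [A X = X B] then [q(A) X = X q(B)] for every polynomial [q], and for
    [q] the characteristic polynomial of [A] the matrix [q(B)] is invertible. *)

Require Import Defs.
From mathcomp Require Import all_boot all_order all_algebra.
From mathcomp Require Import all_classical all_reals all_analysis.
From mathcomp Require Import ring.

Set Implicit Arguments.
Unset Strict Implicit.
Unset Printing Implicit Defensive.
Import Order.TTheory GRing.Theory Num.Theory.
Import numFieldNormedType.Exports.
Local Open Scope classical_set_scope.
Local Open Scope ring_scope.

(** * Characteristic polynomials and Sylvester equations *)

Lemma char_poly_conj (F : fieldType) n (A U : 'M[F]_n) : U \in unitmx ->
  char_poly (invmx U *m A *m U) = char_poly A.
Proof.
move=> uU; rewrite /char_poly.
have -> : char_poly_mx (invmx U *m A *m U) =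
    map_mx polyC (invmx U) *m char_poly_mx A *m map_mx polyC U.
  rewrite /char_poly_mx mulmxBr mulmxBl !map_mxM; congr (_ - _).
  by rewrite mul_mx_scalar -scalemxAl -map_mxM mulVmx// map_mx1 scalemx1.
rewrite !det_mulmx mulrAC -det_mulmx -map_mxM mulVmx//.
by rewrite map_mx1 det1 mul1r.
Qed.

Lemma char_poly_ublock (R : comNzRingType) m p (A : 'M[R]_m) (B : 'M[R]_(m, p))
    (D : 'M[R]_p) :
  char_poly (block_mx A B 0 D) = char_poly A * char_poly D.
Proof.
rewrite /char_poly -(det_ublock _ (- map_mx polyC B)); congr (\det _).
rewrite /char_poly_mx map_block_mx/= map_mx0.
by rewrite scalar_mx_block opp_block_mx add_block_mx oppr0 !add0r.
Qed.

Lemma nilpotent_char_poly (F : fieldType) p (A : 'M[F]_p) :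
  char_poly A = 'X^p -> A ^+ p = 0.
Proof.
(* Size zero is separate: [horner_mx] and [Cayley_Hamilton] are used in the ring of matrices of size
   [p.+1]. *)
case: p A => [A _|p A cA]; first exact: flatmx0.
by rewrite -(Cayley_Hamilton A) cA rmorphXn/= horner_mx_X.
Qed.

Lemma monic_root0_poly (F : closedFieldType) (q : {poly F}) : q \is monic ->
  (forall z, root q z -> z = 0) -> q = 'X^((size q).-1).
Proof.
move=> /monicP q1.
have [r] := closed_field_poly_normal q; rewrite q1 scale1r => ->.
rewrite size_prod_XsubC/= => r0.
elim: r r0  => [|z r IHr] r0; first by rewrite big_nil expr0.
rewrite big_cons IHr => [|y ry]; last by apply: r0; rewrite big_cons rootM ry orbT.
rewrite (r0 z); first by rewrite subr0 exprS.
by rewrite big_cons rootM root_XsubC eqxx.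
Qed.

Lemma char_poly_tr (R : comNzRingType) n (A : 'M[R]_n) :
  char_poly A^T = char_poly A.
Proof.
rewrite /char_poly -[RHS]det_tr; congr (\det _).
by apply/matrixP => i j; rewrite !mxE eq_sym.
Qed.

Section ComplexEigenvalue.
Variable R : realType.

Lemma complex_eigenvalueE n (A : 'M[R]_n) (z : R[i]) :
  complex_eigenvalue A z = root (map_poly (real_complex R) (char_poly A)) z.
Proof.
by rewrite /complex_eigenvalue eigenvalue_root_char map_char_poly.
Qed.

Lemma complex_eigenvalue_tr n (A : 'M[R]_n) (z : R[i]) :
  complex_eigenvalue A^T z = complex_eigenvalue A z.
Proof. by rewrite !complex_eigenvalueE char_poly_tr. Qed.

Lemma complex_eigenvalueN n (A : 'M[R]_n) (z : R[i]) :
  complex_eigenvalue (- A) z -> complex_eigenvalue A (- z).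
Proof.
rewrite /complex_eigenvalue => /eigenvalueP[v vA v0].
apply/eigenvalueP; exists v => //.
by move: vA; rewrite (map_mxN (real_complex R)) mulmxN scaleNr => <-; rewrite opprK.
Qed.

Lemma char_poly_nilpotent n (A : 'M[R]_n) :
  (forall z : R[i], complex_eigenvalue A z -> z = 0) -> char_poly A = 'X^n.
Proof.
move=> A0; apply: (map_poly_inj (real_complex R)).
rewrite map_polyXn [LHS]monic_root0_poly.
- by rewrite size_map_poly size_char_poly.
- by rewrite map_monic char_poly_monic.
- by move=> z; rewrite -complex_eigenvalueE; exact: A0.
Qed.

(** Coprimality is unchanged by passing from [R] to [R[i]], where it means having no common root. *)
Lemma coprime_char_poly m p (A : 'M[R]_m) (B : 'M[R]_p) :
  (forall z : R[i], complex_eigenvalue A z -> complex_eigenvalue B z -> False) ->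
  coprimep (char_poly A) (char_poly B).
Proof.
move=> AB; rewrite -(coprimep_map (real_complex R)).
apply: Pdiv.ClosedField.root_coprimep => z rz; apply/negP => rBz.
by apply: (AB z); rewrite complex_eigenvalueE.
Qed.

End ComplexEigenvalue.

(** [X] intertwines [A] and [- B], hence also every polynomial in them. A Bezout relation provides
    [q] with [q(A) = 0] and [q(- B) = 1], so [X = X q(- B) = q(A) X = 0]. *)
Lemma sylvester_inj (F : fieldType) m p (A : 'M[F]_m) (B : 'M[F]_p)
    (X : 'M[F]_(m, p)) :
  coprimep (char_poly A) (char_poly (- B)) -> A *m X + X *m B = 0 -> X = 0.
Proof.
case: m A X => [A X _ _|m A X]; first exact: flatmx0.
case: p B X => [B X _ _|p B X cAB AX]; first exact: thinmx0.
have AXq q : horner_mx A q *m X = X *m horner_mx (- B) q.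
  elim/poly_ind: q => [|q c IHq]; first by rewrite !rmorph0 mul0mx mulmx0.
  rewrite !rmorphD !rmorphM/= !horner_mx_X !horner_mx_C mulmxDl mulmxDr.
  rewrite mul_scalar_mx mul_mx_scalar; congr (_ + _).
  rewrite -!mulmxE -!mulmxA [RHS]mulmxA -IHq -mulmxA; congr (_ *m _).
  by apply/eqP; rewrite mulmxN -addr_eq0 AX.
have [[u v]/= uv] := Bezout_eq1_coprimepP _ _ cAB.
have uvB : horner_mx (- B) (char_poly A * u) = 1%:M.
  rewrite -[1%:M]/(1 : 'M[F]_p.+1) -(rmorph1 (horner_mx (- B))) -uv rmorphD [RHS]/=.
  by rewrite mulrC (rmorphM _ v)/= Cayley_Hamilton mulr0 addr0.
rewrite -[X]mulmx1 -uvB rmorphM/= -mulmxE mulmxA -AXq.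
by rewrite Cayley_Hamilton !mul0mx.
Qed.

(** An injective endomorphism of a finite-dimensional space is bijective; [lin_mx] represents it by
    a square matrix. *)
Lemma sylvester_solvable (F : fieldType) m p (A : 'M[F]_m) (B : 'M[F]_p)
    (C : 'M[F]_(m, p)) :
  coprimep (char_poly A) (char_poly (- B)) ->
  exists! X : 'M[F]_(m, p), A *m X + X *m B = C.
Proof.
move=> cAB; pose L : {linear 'M[F]_(m, p) -> 'M[F]_(m, p)} := mulmx A \+ mulmxr B.
have uL : lin_mx L \in unitmx.
  rewrite -row_free_unit; apply: inj_row_free => v /(congr1 vec_mx).
  rewrite mx_rV_lin linear0 => /(sylvester_inj cAB) v0.
  by rewrite -[v]vec_mxK v0 linear0.
exists (vec_mx (mxvec C *m invmx (lin_mx L))); split.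
  by rewrite -[LHS]/(L _) -mx_rV_lin mulmxKV// mxvecK.
by move=> X <-; rewrite -[_ + _]/(L X) -mul_vec_lin mulmxK// mxvecK.
Qed.

(** * Orthogonal deflation of the eigenvalue zero *)

Section Deflation.
Variable R : rcfType.

Lemma mul_row_tr_eq0 n (v : 'rV[R]_n) : (v *m v^T == 0) = (v == 0).
Proof.
apply/eqP/eqP => [/matrixP/(_ 0 0)|->]; last by rewrite mul0mx.
rewrite !mxE => /eqP; rewrite psumr_eq0 => [/allP v0|i _]; last first.
  by rewrite mxE -expr2 sqr_ge0.
apply/rowP => j; have := v0 j (mem_index_enum _).
by rewrite !mxE mulf_eq0 orbb => /eqP.
Qed.

(* The reflection exchanging the unit vectors u and w. *)
Lemma householder n (u w : 'rV[R]_n) : u *m u^T = 1%:M -> w *m w^T = 1%:M ->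
  exists2 H : 'M[R]_n, H^T *m H = 1%:M & u *m H = w.
Proof.
move=> uu ww; have [->|uw] := eqVneq u w.
  by exists 1%:M; rewrite ?trmx1 mulmx1.
(* [v] is normal to the mirror, [b] is the inner product of [u] and [w], and [a] is the squared
   length of [v]. *)
pose v := u - w; pose b := (u *m w^T) 0 0; pose a := 2 - 2 * b.
have ubw : u *m w^T = b%:M by rewrite [LHS]mx11_scalar.
have wbu : w *m u^T = b%:M by rewrite -[LHS]trmxK trmx_mul trmxK ubw tr_scalar_mx.
have vv : v *m v^T = a%:M.
  rewrite /v linearB/= mulmxBl !mulmxBr uu ww ubw wbu -!raddfB/=.
  by congr (_%:M); rewrite /a; ring.
have uv : u *m v^T = (1 - b)%:M by rewrite /v linearB/= mulmxBr uu ubw raddfB.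
have a0 : a != 0.
  apply: contraNneq uw => a0; rewrite -subr_eq0 -mul_row_tr_eq0 -/v vv a0.
  by rewrite raddf0.
pose c := 2 / a; pose P := v^T *m v.
have PT : P^T = P by rewrite /P trmx_mul trmxK.
have PP : P *m P = a *: P.
  by rewrite /P mulmxA -(mulmxA _ v) vv mul_mx_scalar -scalemxAl.
(* This identity makes the symmetric matrix [1%:M - c *: P] an involution, hence orthogonal. *)
have ca : c * c * a = c + c by rewrite /c; field.
exists (1%:M - c *: P).
  have -> : (1%:M - c *: P)^T = 1%:M - c *: P.
    by rewrite raddfB/= trmx1 linearZ/= PT.
  rewrite mulmxBl mul1mx -scalemxAl mulmxBr mulmx1.
  rewrite -scalemxAr PP scalerBr !scalerA ca scalerDl.
  by rewrite opprB addrK subrK.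
rewrite mulmxBr mulmx1 -scalemxAr /P mulmxA uv mul_scalar_mx scalerA.
have -> : c * (1 - b) = 1 by rewrite /c; move: a0; rewrite /a => a0; field.
by rewrite scale1r /v subKr.
Qed.

Lemma char_poly_dvdX_root n k (A : 'M[R]_n) : 'X^(k.+1) %| char_poly A ->
  exists2 w : 'rV[R]_n, w *m A = 0 & w *m w^T = 1%:M.
Proof.
move=> kA.
have : eigenvalue A 0.
  rewrite eigenvalue_root_char -dvdp_XsubCl subr0.
  by apply: dvdp_trans kA; rewrite exprS dvdp_mulr.
move=> /eigenvalueP[w wA w0]; pose c := (w *m w^T) 0 0.
have wc : w *m w^T = c%:M by rewrite [LHS]mx11_scalar.
have c0 : 0 < c.
  rewrite lt_def; apply/andP; split.
    apply: contraNneq w0 => c0; rewrite -mul_row_tr_eq0 wc c0 raddf0.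
    exact: eqxx.
  by rewrite /c mxE sumr_ge0// => i _; rewrite mxE -expr2 sqr_ge0.
exists ((Num.sqrt c)^-1 *: w); first by rewrite -scalemxAl wA scale0r scaler0.
rewrite linearZ/= -scalemxAl -scalemxAr wc scalerA -invfM -expr2 sqr_sqrtr ?ltW//.
by rewrite scale_scalar_mx mulVf// gt_eqF.
Qed.

(* Each step moves a unit left null vector to the last coordinate and recurses
   on the remaining leading block. *)
Lemma orthogonal_deflation k n (A : 'M[R]_n) : 'X^k %| char_poly A ->
  exists2 U : 'M[R]_n, U^T *m U = 1%:M &
    forall i j : 'I_n, (n - k <= i)%N -> (j <= i)%N -> (U^T *m A *m U) i j = 0.
Proof.
elim: k n A => [|k IHk] n A kA.
  exists 1%:M; first by rewrite trmx1 mulmx1.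
  by move=> i j; rewrite subn0 leqNgt ltn_ord.
have [w wA ww] := char_poly_dvdX_root kA.
case: n A kA w wA ww => [|n] A kA w wA ww.
  by exists 1%:M => [|[]//]; rewrite trmx1 mulmx1.
move: A kA w wA ww; rewrite -addn1 => A kA w wA ww.
pose e : 'rV[R]_(n + 1) := row_mx 0 1%:M.
have ee : e *m e^T = 1%:M.
  by rewrite /e tr_row_mx mul_row_col trmx0 mul0mx add0r trmx1 mulmx1.
have [H HH wH] := householder ww ee.
have HHt : H *m H^T = 1%:M by rewrite mulmx1C.
pose B := H^T *m A *m H.
(* Since [e = w H] with [H] orthogonal, the last row of [B] is [w A H = 0]. *)
have eB : e *m B = 0.
  by rewrite /B -wH -!mulmxA (mulmxA H) HHt mul1mx mulmxA wA mul0mx.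
have BE : B = block_mx (ulsubmx B) (ursubmx B) 0 0.
  rewrite -[LHS]submxK; move: eB; rewrite -{1}[B]submxK /e mul_row_block.
  by rewrite !mul0mx !add0r !mul1mx -row_mx0 => /eq_row_mx[-> ->].
have HV : invmx H = H^T.
  have uH : H \in unitmx by case/mulmx1_unit: HH.
  by rewrite -[LHS]mul1mx -HH -mulmxA mulmxV// mulmx1.
(* The zero last row splits off one factor ['X], leaving ['X^k] as a divisor for the leading
   block. *)
have cB : char_poly A = char_poly (ulsubmx B) * 'X.
  rewrite -(char_poly_conj A (proj2 (mulmx1_unit HH))) HV -/B {1}BE.
  rewrite char_poly_ublock; congr (_ * _).
  by rewrite /char_poly /char_poly_mx map_mx0 subr0 det_scalar expr1.
have {}kA : 'X^k %| char_poly (ulsubmx B).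
  by move: kA; rewrite cB exprSr dvdp_mul2r// polyX_eq0.
have [V VV Vl] := IHk _ _ kA.
exists (H *m block_mx V 0 0 1%:M).
  rewrite trmx_mul mulmxA -(mulmxA _ H^T) HH mulmx1 tr_block_mx !trmx0 trmx1.
  rewrite mulmx_block !mulmx0 !mul0mx !mulmx1 !addr0 add0r VV.
  by rewrite -scalar_mx_block.
have -> : (H *m block_mx V 0 0 1%:M)^T *m A *m (H *m block_mx V 0 0 1%:M) =
    block_mx (V^T *m ulsubmx B *m V) (V^T *m ursubmx B) 0 0.
  rewrite trmx_mul !mulmxA -(mulmxA _ H^T A) -(mulmxA _ (H^T *m A)) -/B {1}BE.
  rewrite tr_block_mx !trmx0 trmx1 !mulmx_block.
  by rewrite !mulmx0 !mul0mx !mulmx1 !addr0 !add0r mul0mx.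
(* The last row is zero. In the other rows [j <= i] excludes the last column, and
   [n + 1 - (k + 1) = n - k] matches the induction hypothesis. *)
move=> i j; have [i' ->|i' ->] := split_ordP i; last first.
  move=> _ _; have [j' ->|j' ->] := split_ordP j.
  - by rewrite block_mxEdl mxE.
  - by rewrite block_mxEdr mxE.
have [j' ->|j' ->] := split_ordP j; last first.
  by move=> _ /=; rewrite leqNgt ltn_addr.
rewrite block_mxEul /= => ni ji; apply: Vl => //.
by rewrite -subSS -addn1.
Qed.

End Deflation.

(** * The matrix exponential *)

(** Entries of [phi M] are fixed linear combinations of entries of [M]; this is how limits and
    integrals pass through linear maps. *)
Lemma linear_mx_entry (R : comPzRingType) m n p q
    (phi : {linear 'M[R]_(m, n) -> 'M[R]_(p, q)}) (M : 'M[R]_(m, n)) i j :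
  phi M i j = \sum_k M k.1 k.2 * phi (delta_mx k.1 k.2) i j.
Proof.
rewrite {1}[M]matrix_sum_delta pair_big/= linear_sum summxE.
by apply: eq_bigr => k _; rewrite linearZ mxE.
Qed.

Section MatrixLimit.
Variable R : realType.

Lemma cvg_mx (T : Type) (F : set_system T) {FF : Filter F} m n
    (f : T -> 'M[R]_(m, n)) (L : 'M[R]_(m, n)) :
  (forall i j, f x i j @[x --> F] --> L i j) -> f @ F --> L.
Proof.
move=> fL; apply/cvgrPdist_le => /= e e0.
near=> x.
rewrite /Num.Def.normr/= mx_normrE (bigmax_le _ (ltW e0))//= => i _.
rewrite !mxE/=.
move: i; near: x; apply: filter_forall => /= i.
exact: ((cvgrPdist_le _ _).1 (fL i.1 i.2)).
Unshelve. all: by end_near. Qed.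

Lemma cvg_mx_entry (T : Type) (F : set_system T) {FF : Filter F} m n
    (f : T -> 'M[R]_(m, n)) (L : 'M[R]_(m, n)) i j :
  f @ F --> L -> f x i j @[x --> F] --> L i j.
Proof.
move=> fL; apply: (@continuous_cvg _ _ _ F FF f (fun M => M i j)) => //.
exact: coord_continuous.
Qed.

Lemma cvg_linear_mx (T : Type) (F : set_system T) {FF : Filter F} m n p q
    (phi : {linear 'M[R]_(m, n) -> 'M[R]_(p, q)})
    (f : T -> 'M[R]_(m, n)) (L : 'M[R]_(m, n)) :
  f @ F --> L -> phi (f x) @[x --> F] --> phi L.
Proof.
move=> fL; apply: cvg_mx => i j.
under eq_fun do rewrite linear_mx_entry.
rewrite linear_mx_entry; apply: cvg_big => [|k _]; first exact: add_continuous.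
by apply: cvgM; [exact: cvg_mx_entry|exact: cvg_cst].
Qed.

End MatrixLimit.

Section MatrixExponential.
Variable R : realType.

(** The maximum norm is not submultiplicative: an entry of a product is a sum of [n] terms, whence
    the factor [n] at each power. *)
Lemma exprmx_le n (M : 'M[R]_n) (k : nat) i j :
  `|(M ^+ k) i j| <= (n%:R * `|M|) ^+ k.
Proof.
elim: k i j => [|k IHk] i j.
  by rewrite !expr0 mxE; case: (i == j); rewrite ?normr1 ?normr0.
rewrite exprS -mulmxE mxE (le_trans (ler_norm_sum _ _ _))//.
rewrite exprS -mulrA -[X in _ <= X%:R * _](card_ord n) -sum1_card natr_sum mulr_suml.
apply: ler_sum => l _; rewrite mul1r normrM ler_pM//.
rewrite [leRHS]/Num.Def.normr/= mx_normrE.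
exact: (le_bigmax _ _ (i, l)).
Qed.

(* exprZn does not apply: 'M[R]_n is an algebra only for nonzero n. *)
Lemma exprmxZ n (x : R) (M : 'M[R]_n) k : (x *: M) ^+ k = x ^+ k *: M ^+ k.
Proof.
elim: k => [|k IHk]; first by rewrite !expr0 scale1r.
by rewrite !exprS -!mulmxE IHk -scalemxAl -scalemxAr scalerA.
Qed.

Definition expmx_coef n (M : 'M[R]_n) i j (k : nat) : R := (k`!%:R)^-1 * (M ^+ k) i j.

Lemma is_cvg_expmx_coef n (M : 'M[R]_n) i j : cvgn (series (expmx_coef M i j)).
Proof.
apply: normed_cvg.
apply: series_le_cvg (is_cvg_series_exp_coeff (n%:R * `|M|)) => k //=.
  by rewrite /exp_coeff/= mulr_ge0 ?exprn_ge0 ?mulr_ge0 ?invr_ge0 ?ler0n.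
rewrite /exp_coeff/= /expmx_coef normrM normfV normr_nat mulrC.
by rewrite ler_wpM2r ?invr_ge0 ?ler0n// exprmx_le.
Qed.

(** [limn] is meaningful only for convergent sequences, so this is what makes [expmx] the genuine
    sum of its series. *)
Lemma cvg_expmx n (M : 'M[R]_n) :
  series (fun k => (k`!%:R)^-1 *: (M ^+ k)) @ \oo --> expmx M.
Proof.
apply/cvg_ex; exists (\matrix_(i, j) limn (series (expmx_coef M i j))).
apply: cvg_mx => i j; rewrite mxE.
under eq_fun do rewrite /series/= summxE.
under eq_fun do under eq_bigr do rewrite mxE.
exact: is_cvg_expmx_coef.
Qed.

Lemma expmx_lim n (M L : 'M[R]_n) :
  series (fun k => (k`!%:R)^-1 *: (M ^+ k)) @ \oo --> L -> expmx M = L.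
Proof. exact/cvg_lim/norm_hausdorff. Qed.

Lemma cvg_linear_expmx n p q (phi : {linear 'M[R]_n -> 'M[R]_(p, q)}) (M : 'M[R]_n) :
  series (fun k => (k`!%:R)^-1 *: phi (M ^+ k)) @ \oo --> phi (expmx M).
Proof.
rewrite (_ : series _ = phi \o series (fun k => (k`!%:R)^-1 *: (M ^+ k))).
  by apply: cvg_linear_mx; exact: cvg_expmx.
apply/funext => N /=; rewrite /series/= linear_sum.
by apply: eq_bigr => k _; rewrite linearZ.
Qed.

(** A linear map commutes with the sum of the series, so an identity on all powers carries over to
    exponentials. Conjugation, transposition and extraction of a diagonal block are treated this
    way. *)
Lemma linear_expmx n p (phi : {linear 'M[R]_n -> 'M[R]_p}) (M : 'M[R]_n) (N : 'M[R]_p) :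
  (forall k, phi (M ^+ k) = N ^+ k) -> phi (expmx M) = expmx N.
Proof.
move=> MN; apply/esym/expmx_lim; have := @cvg_linear_expmx _ _ _ phi M.
by under [X in series X]eq_fun do rewrite MN.
Qed.

Lemma linear_expmx0 n p q (phi : {linear 'M[R]_n -> 'M[R]_(p, q)}) (M : 'M[R]_n) :
  (forall k, phi (M ^+ k) = 0) -> phi (expmx M) = 0.
Proof.
move=> M0; have /cvg_lim <- := @cvg_linear_expmx _ _ _ phi M; last first.
  exact: norm_hausdorff.
rewrite (_ : series _ = cst 0); first exact: lim_cst.
by apply/funext => N; rewrite /series/= big1// => k _; rewrite M0 scaler0.
Qed.

Lemma expmx_conj n (M U : 'M[R]_n) : U \in unitmx ->
  U *m expmx M *m invmx U = expmx (U *m M *m invmx U).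
Proof.
move=> uU; apply: (@linear_expmx _ _ (mulmxr (invmx U) \o mulmx U)) => k /=.
elim: k => [|k IHk]; first by rewrite !expr0 mulmx1 mulmxV.
by rewrite !exprS -IHk -!mulmxE !mulmxA mulmxKV.
Qed.

Lemma trmx_expmx n (M : 'M[R]_n) : (expmx M)^T = expmx M^T.
Proof.
apply: linear_expmx => k; elim: k => [|k IHk]; first exact: trmx1.
by rewrite exprSr exprS -!mulmxE /= trmx_mul -IHk.
Qed.

Lemma expmx0 n : expmx (0 : 'M[R]_n) = 1%:M.
Proof.
apply: expmx_lim; apply: cvg_near_cst; near=> N.
rewrite /series/= -(prednK (_ : 0 < N)%N); last by near: N; exact: nbhs_infty_gt.
rewrite big_nat_recl// big1 ?addr0 => [|k _]; first by rewrite expr0 invr1 scale1r.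
by rewrite exprS mul0r scaler0.
Unshelve. all: by end_near. Qed.

Lemma expmx_nilpotent n p (M : 'M[R]_n) : M ^+ p = 0 ->
  expmx M = \sum_(k < p) (k`!%:R)^-1 *: (M ^+ k).
Proof.
move=> M0; apply: expmx_lim; apply: cvg_near_cst; near=> N.
have pN : (p <= N)%N by near: N; exact: nbhs_infty_ge.
rewrite /series/= (big_cat_nat (leq0n p) pN)/= big_mkord [X in _ + X]big1_seq ?addr0// => k.
rewrite mem_index_iota => /andP[_ /andP[pk _]].
by rewrite -(subnKC pk) exprD M0 mul0r scaler0.
Unshelve. all: by end_near. Qed.

Section BlockTriangular.
Variables (m p : nat) (M : 'M[R]_(m + p)).
Hypothesis dlM : dlsubmx M = 0.

Let block_exprmx k :
  dlsubmx (M ^+ k) = 0 /\ drsubmx (M ^+ k) = drsubmx M ^+ k.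
Proof.
elim: k => [|k [IHl IHr]].
  have -> : M ^+ 0 = block_mx 1%:M 0 0 1%:M by exact: scalar_mx_block.
  by rewrite block_mxKdl block_mxKdr.
rewrite exprS -mulmxE -[M in M *m _]submxK -[M ^+ k]submxK dlM IHl IHr.
rewrite mulmx_block block_mxKdl block_mxKdr !mul0mx mulmx0 !add0r.
by rewrite exprS.
Qed.

Lemma dlsubmx_expmx : dlsubmx (expmx M) = 0.
Proof.
apply: (@linear_expmx0 _ _ _ (@lsubmx R p m p \o @dsubmx R m p (m + p))) => k.
exact: (block_exprmx k).1.
Qed.

Lemma drsubmx_expmx : drsubmx (expmx M) = expmx (drsubmx M).
Proof.
apply: (@linear_expmx _ _ (@rsubmx R p m p \o @dsubmx R m p (m + p))) => k.
exact: (block_exprmx k).2.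
Qed.

End BlockTriangular.

(** Each entry is a scalar power series in [x], differentiated term by term. *)
Lemma is_derive_expmx n (M : 'M[R]_n) i j (t : R) :
  is_derive t 1 (fun x => expmx (x *: M) i j) ((M *m expmx (t *: M)) i j).
Proof.
(* The left factor [N] keeps this family of coefficients closed under differentiation, which turns
   [N] into [N M]. *)
pose c (N : 'M[R]_n) (k : nat) : R := (k`!%:R)^-1 * (N *m M ^+ k) i j.
have cN (N : 'M[R]_n) x : pseries (c N) x @ \oo --> (N *m expmx (x *: M)) i j.
  rewrite (_ : pseries (c N) x =
      fun K => series (fun k => (k`!%:R)^-1 *: (N *m (x *: M) ^+ k)) K i j).
    by apply: cvg_mx_entry; exact: (@cvg_linear_expmx _ _ _ (mulmx N)).
  apply/funext => K; rewrite /pseries /series/= summxE; apply: eq_bigr => k _.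
  by rewrite exprmxZ mxE -scalemxAr mxE /c; ring.
have cE (N : 'M[R]_n) x : (N *m expmx (x *: M)) i j = limn (pseries (c N) x).
  by apply/esym/cvg_lim; [exact: norm_hausdorff|exact: cN].
have cc (N : 'M[R]_n) x : cvgn (pseries (c N) x) by exact: cvgP (cN N x).
have dc N : pseries_diffs (c N) = c (N *m M).
  apply/funext => k; rewrite /pseries_diffs /c exprS -mulmxE mulmxA.
  by rewrite factS natrM invfM mulrA mulVKf.
rewrite (_ : (fun x => _) = fun x => limn (pseries (c 1%:M) x)); last first.
  by apply/funext => x; rewrite -cE mul1mx.
rewrite -[M in M *m _]mul1mx cE -dc.
(* Any radius exceeding the absolute value of [t] would do, since the series and its derived series
   converge everywhere. *)
apply: (@pseries_snd_diffs _ _ (`|t| + 1)); rewrite ?dc; try exact: cc.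
by rewrite [ltRHS]ger0_norm// ltrDl.
Qed.

End MatrixExponential.

(** * Calculus of matrix-valued functions *)

Section MatrixCalculus.
Variable R : realType.

(** Entrywise like [integral_mx], so that the scalar rules and the fundamental theorem of calculus
    apply to each entry. *)
Definition is_derive_mx m n (f f' : R -> 'M[R]_(m, n)) : Prop :=
  forall (t : R) i j, is_derive t 1 (fun x => f x i j) (f' t i j).

Definition continuous_mx m n (f : R -> 'M[R]_(m, n)) : Prop :=
  forall i j, continuous (fun x => f x i j).

Lemma is_derive_mx_continuous m n (f f' : R -> 'M[R]_(m, n)) :
  is_derive_mx f f' -> continuous_mx f.
Proof.
move=> ff' i j t; have := ff' t i j => dt.
by apply/differentiable_continuous/derivable1_diffP; exact: ex_derive.
Qed.

Lemma is_derive_mx_cst m n (C : 'M[R]_(m, n)) : is_derive_mx (cst C) (cst 0).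
Proof. by move=> t i j; rewrite mxE; exact: is_derive_cst. Qed.

Lemma is_derive_mx_tr m n (f f' : R -> 'M[R]_(m, n)) :
  is_derive_mx f f' -> is_derive_mx (fun t => (f t)^T) (fun t => (f' t)^T).
Proof.
move=> ff' t i j; rewrite mxE.
by under eq_fun do rewrite mxE; exact: ff'.
Qed.

Lemma is_derive_mxM m n p (f f' : R -> 'M[R]_(m, n)) (g g' : R -> 'M[R]_(n, p)) :
  is_derive_mx f f' -> is_derive_mx g g' ->
  is_derive_mx (fun t => f t *m g t) (fun t => f' t *m g t + f t *m g' t).
Proof.
move=> ff' gg' t i j.
pose h k := (fun x => f x i k) * (fun x => g x k j).
have hE : (fun x => (f x *m g x) i j) = \sum_k h k.
  by apply/funext => x; rewrite mxE fct_sumE.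
have dh k : is_derive t 1 (h k) (f' t i k * g t k j + f t i k * g' t k j).
  apply: is_derive_eq; first by apply: is_deriveM; [exact: ff'|exact: gg'].
  by rewrite addrC /GRing.scale/= (mulrC (g t k j)).
rewrite hE !mxE -big_split/=; exact: is_derive_sum.
Qed.

Lemma is_derive_mx_sum m n N (f f' : 'I_N -> R -> 'M[R]_(m, n)) :
  (forall k, is_derive_mx (f k) (f' k)) ->
  is_derive_mx (fun t => \sum_k f k t) (fun t => \sum_k f' k t).
Proof.
move=> ff' t i j.
have -> : (fun x => (\sum_k f k x) i j) = \sum_k (fun x => f k x i j).
  by apply/funext => x; rewrite summxE fct_sumE.
by rewrite summxE; apply: is_derive_sum => k; exact: ff'.
Qed.

(** Produces the denominators of the closed form of [Q22], with [c] a product of two factorials and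
    [k = i + j]. *)
Lemma is_derive_mx_monomial m n (c : R) k (X : 'M[R]_(m, n)) : c != 0 ->
  is_derive_mx (fun t => (t ^+ k.+1 / (c * k.+1%:R)) *: X)
               (fun t => (t ^+ k / c) *: X).
Proof.
move=> c0 t i j.
have -> : (fun x => (x ^+ k.+1 / (c * k.+1%:R) *: X) i j) =
    (X i j / (c * k.+1%:R)) \*: (@id R ^+ k.+1).
  by apply/funext => x; rewrite mxE fctE/= /GRing.scale/=; ring.
apply: is_derive_eq.
rewrite mxE /GRing.scale/= mulr1.
by field; rewrite c0 nat1r pnatr_eq0.
Qed.

Lemma is_derive_expmx_mx n (A : 'M[R]_n) :
  is_derive_mx (fun t => expmx (t *: A)) (fun t => A *m expmx (t *: A)).
Proof. by move=> t i j; exact: is_derive_expmx. Qed.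

Lemma continuous_sum (I : finType) (f : I -> R -> R) :
  (forall k, continuous (f k)) -> continuous (fun x => \sum_k f k x).
Proof.
move=> fc x; apply: cvg_big => [|k _]; first exact: add_continuous.
exact: fc.
Qed.

Lemma continuous_mx_integrable m n (f : R -> 'M[R]_(m, n)) i j (a b : R) :
  continuous_mx f ->
  (@lebesgue_measure R).-integrable `[a, b] (EFin \o (fun x => f x i j)).
Proof.
move=> fc; apply: continuous_compact_integrable; first exact: segment_compact.
exact/continuous_subspaceT/fc.
Qed.

Lemma Rintegral_sum (I : Type) (s : seq I) (f : I -> R -> R) (D : set R) :
  measurable D ->
  (forall k, (@lebesgue_measure R).-integrable D (EFin \o f k)) ->
  Rintegral (@lebesgue_measure R) D (fun x => \sum_(k <- s) f k x) =
  \sum_(k <- s) Rintegral (@lebesgue_measure R) D (f k).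
Proof.
move=> mD fi; elim: s => [|k s IHs].
  under eq_Rintegral do rewrite big_nil.
  by rewrite big_nil Rintegral_cst// mul0r.
under eq_Rintegral do rewrite big_cons.
rewrite big_cons -IHs RintegralD//.
rewrite (_ : _ \o _ = fun x => (\sum_(k <- s) (f k x)%:E)%E).
  by apply: integrable_sum => // k' _; exact: fi.
by apply/funext => x /=; rewrite sumEFin.
Qed.

Lemma linear_integral_mx m n p q (phi : {linear 'M[R]_(m, n) -> 'M[R]_(p, q)})
    (f : R -> 'M[R]_(m, n)) (a b : R) : continuous_mx f ->
  integral_mx a b (phi \o f) = phi (integral_mx a b f).
Proof.
move=> fc; apply/matrixP => i j; rewrite linear_mx_entry mxE.
under eq_Rintegral do rewrite /= linear_mx_entry.
rewrite Rintegral_sum// => [|k].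
  apply: eq_bigr => k _; rewrite mxE RintegralZr//.
  exact: continuous_mx_integrable.
apply: continuous_compact_integrable; first exact: segment_compact.
apply/continuous_subspaceT => x.
by apply: cvgM; [exact: fc|exact: cvg_cst].
Qed.

Lemma trmx_integral_mx m n (f : R -> 'M[R]_(m, n)) (a b : R) :
  (integral_mx a b f)^T = integral_mx a b (fun t => (f t)^T).
Proof.
apply/matrixP => i j; rewrite !mxE.
by apply: eq_Rintegral => t _; rewrite mxE.
Qed.

Lemma drsubmx_integral_mx m n p q (f : R -> 'M[R]_(m + n, p + q)) (a b : R) :
  drsubmx (integral_mx a b f) = integral_mx a b (fun t => drsubmx (f t)).
Proof.
apply/matrixP => i j; rewrite !mxE.
by apply: eq_Rintegral => t _; rewrite !mxE.
Qed.

Lemma integral_mx_derive m n (f f' : R -> 'M[R]_(m, n)) (a b : R) : a < b ->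
  is_derive_mx f f' -> continuous_mx f' -> integral_mx a b f' = f b - f a.
Proof.
move=> ab ff' f'c; apply/matrixP => i j; rewrite !mxE /Rintegral.
rewrite (@continuous_FTC2 _ _ (fun x => f x i j))//.
- exact/continuous_subspaceT/f'c.
- have fc := is_derive_mx_continuous ff'.
  split=> [x _||].
  + by have := ff' x i j => d; exact: ex_derive.
  + by apply: cvg_at_right_filter; exact: fc.
  + by apply: cvg_at_left_filter; exact: fc.
- by move=> x _; have := ff' x i j => d; rewrite derive1E derive_val.
Qed.

(** * Gramians *)

Section Gramian.
Variables (n : nat) (A S : 'M[R]_n).

(** With a transposed exponential instead of the exponential of [A^T], the product rule calls only
    for the derivative of [expmx (t *: A)]. *)
Definition gramian_integrand (t : R) : 'M[R]_n :=
  expmx (t *: A) *m S *m (expmx (t *: A))^T.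

Lemma is_derive_gramian_integrand :
  is_derive_mx gramian_integrand
    (fun t => A *m gramian_integrand t + gramian_integrand t *m A^T).
Proof.
have dA := is_derive_expmx_mx A.
have := is_derive_mxM (is_derive_mxM dA (is_derive_mx_cst S)) (is_derive_mx_tr dA).
congr is_derive_mx; apply/funext => t; rewrite /gramian_integrand /cst.
by rewrite mulmx0 addr0 trmx_mul !mulmxA.
Qed.

Lemma continuous_gramian_integrand : continuous_mx gramian_integrand.
Proof. exact: is_derive_mx_continuous is_derive_gramian_integrand. Qed.

Lemma gramian_lyapunov (T : R) : 0 < T ->
  let Q := integral_mx 0 T gramian_integrand in
  A *m Q + Q *m A^T =
  - (S - expmx (T *: A) *m S *m (expmx (T *: A))^T).
Proof.
move=> T0 Q.
(* As one linear map, the left-hand side goes under the integral, where it yields the derivative of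
   the integrand. *)
pose L : {linear 'M[R]_n -> 'M[R]_n} := mulmx A \+ mulmxr A^T.
have -> : A *m Q + Q *m A^T = L Q by [].
rewrite -linear_integral_mx; last exact: continuous_gramian_integrand.
rewrite (integral_mx_derive T0 is_derive_gramian_integrand).
  by rewrite /gramian_integrand scale0r expmx0 mul1mx trmx1 mulmx1 opprB.
move=> i j.
have -> : (fun x => (A *m gramian_integrand x + gramian_integrand x *m A^T) i j) =
  (fun x => L (gramian_integrand x) i j) by [].
under eq_fun do rewrite linear_mx_entry.
apply: continuous_sum => k y.
by apply: cvgM; [exact: continuous_gramian_integrand|exact: cvg_cst].
Qed.

Lemma trmx_gramian (T : R) : S^T = S ->
  (integral_mx 0 T gramian_integrand)^T = integral_mx 0 T gramian_integrand.
Proof.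
move=> S_sym; rewrite trmx_integral_mx; congr integral_mx; apply/funext => t.
by rewrite /gramian_integrand !trmx_mul trmxK S_sym mulmxA.
Qed.

Lemma gramian_nilpotent (T : R) p : 0 < T -> A ^+ p = 0 ->
  integral_mx 0 T gramian_integrand =
  \sum_(i < p) \sum_(j < p)
    (T ^+ (i + j + 1) / (i`!%:R * j`!%:R * (i + j + 1)%:R)) *:
      (A ^+ i *m S *m (A ^+ j)^T).
Proof.
move=> T0 Ap.
(* The integrand is a polynomial in [t]; this antiderivative raises each exponent [i + j] by one, so
   it vanishes at zero. *)
pose F (t : R) : 'M[R]_n := \sum_(i < p) \sum_(j < p)
  (t ^+ (i + j).+1 / (i`!%:R * j`!%:R * (i + j).+1%:R)) *:
    (A ^+ i *m S *m (A ^+ j)^T).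
have F0 : F 0 = 0.
  by rewrite /F big1// => i _; rewrite big1// => j _; rewrite exprS !mul0r scale0r.
have dF : is_derive_mx F gramian_integrand.
  have -> : gramian_integrand = fun t => \sum_(i < p) \sum_(j < p)
      (t ^+ (i + j) / (i`!%:R * j`!%:R)) *: (A ^+ i *m S *m (A ^+ j)^T).
    apply/funext => t; rewrite /gramian_integrand (@expmx_nilpotent _ _ p); last first.
      by rewrite exprmxZ Ap scaler0.
    rewrite mulmx_suml raddf_sum/= mulmx_suml; apply: eq_bigr => i _.
    rewrite mulmx_sumr; apply: eq_bigr => j _.
    rewrite !exprmxZ !scalerA [(_ *: A ^+ j)^T]linearZ/= -!scalemxAl -scalemxAr scalerA; congr (_ *: _).
    by rewrite exprD invfM; ring.
  apply: is_derive_mx_sum => i; apply: is_derive_mx_sum => j.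
  by apply: is_derive_mx_monomial; rewrite mulf_neq0// pnatr_eq0 -lt0n fact_gt0.
rewrite (integral_mx_derive T0 dF continuous_gramian_integrand) F0 subr0.
by apply: eq_bigr => i _; apply: eq_bigr => j _; rewrite addn1.
Qed.

End Gramian.

End MatrixCalculus.

(** * Existence and spectrum of the splitting *)

Section ZeroSplitting.
Variable R : realType.

Lemma orthogonal_invmx n (U : 'M[R]_n) : U^T *m U = 1%:M -> invmx U = U^T.
Proof.
move=> UU; have [_ uU] := mulmx1_unit UU.
by rewrite -[LHS]mul1mx -UU mulmxK.
Qed.

(** After [p] deflations the last [p] rows vanish up to and including the diagonal, so the lower
    block has characteristic polynomial ['X^p]. As [p] is the full multiplicity of zero, none is
    left for the upper block. *)
Lemma zero_splitting_exists n m p (e : (m + p)%N = n) (A : 'M[R]_n) :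
  p = alg_mult A 0 -> exists2 U, zero_splitting e A U & U^T *m U = 1%:M.
Proof.
(* Eliminating [e] makes the casts of [to_blocks] compute to identities. *)
case: n / e A => A pA.
have A0 : char_poly A != 0 by rewrite monic_neq0 ?char_poly_monic.
have [|U UU Uij] := @orthogonal_deflation R p _ A.
  by rewrite -['X]subr0 -mup_geq// -/(alg_mult A 0) -pA.
exists U => //; have [_ uU] := mulmx1_unit UU.
rewrite /zero_splitting orthogonal_invmx//.
rewrite -[to_blocks _ _]/(U^T *m A *m U).
have := char_poly_conj A uU; rewrite orthogonal_invmx//.
move: (U^T *m A *m U) Uij => B Bij cBA.
have dlB : dlsubmx B = 0.
  by apply/matrixP => i j; rewrite !mxE Bij//= ?addnK ?leq_addr// ltnW// ltn_addr.
have cB : char_poly (drsubmx B) = 'X^p.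
  (* The block is upper triangular while [char_poly_trig] concerns lower triangular matrices, hence
     the transpose. *)
  rewrite -char_poly_tr char_poly_trig; last first.
    apply/is_trig_mxP => i j ij; rewrite !mxE Bij//= ?addnK ?leq_addr//.
    by rewrite leq_add2l ltnW.
  under eq_bigr => i _ do rewrite !mxE Bij//= ?addnK ?leq_addr// subr0.
  by rewrite prodr_const card_ord.
have cA : char_poly A = char_poly (ulsubmx B) * 'X^p.
  by rewrite -cB -(char_poly_ublock _ (ursubmx B)) -dlB submxK.
split=> // z; rewrite complex_eigenvalueE; last first.
  rewrite cB map_polyXn rootE hornerXn expf_eq0 => /andP[_ /eqP//].
move=> rz; apply: contraTneq rz => ->.
rewrite -(rmorph0 (real_complex R)) fmorph_root.
have B0 : char_poly (ulsubmx B) != 0 by rewrite monic_neq0 ?char_poly_monic.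
(* Multiplicities of zero add up, and ['X^p] already contributes the total [p]. *)
move: pA; rewrite /alg_mult cA mupM ?monic_neq0 ?monicXn ?char_poly_monic//.
rewrite -['X]subr0 mup_XsubCX eqxx => /eqP.
rewrite -[X in X == _]add0n eqn_add2r eq_sym => /eqP B00.
by rewrite -dvdp_XsubCl XsubC_dvd// B00.
Qed.

(** The characteristic polynomial of [A] is the product of those of the diagonal blocks. This brings
    the assumption on the eigenvalues of [A] to the upper block. *)
Lemma zero_splitting_eigenvalue n m p (e : (m + p)%N = n) (A U : 'M[R]_n)
    (z : R[i]) :
  zero_splitting e A U ->
  complex_eigenvalue (ulsubmx (to_blocks e (invmx U *m A *m U))) z ->
  complex_eigenvalue A z.
Proof.
case: n / e A U => A U [uU dl0 _ _].
rewrite !complex_eigenvalueE -(char_poly_conj A uU).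
move: dl0; rewrite -[to_blocks _ _]/(invmx U *m A *m U).
move: (invmx U *m A *m U) => B dl0.
by rewrite -[B in X in _ -> X]submxK dl0 char_poly_ublock rmorphM rootM => ->.
Qed.

End ZeroSplitting.

(** * Block equations of the Gramian in triangular coordinates *)

Section BlockGramian.
Variables (R : realType) (m p : nat) (A S : 'M[R]_(m + p)) (T : R).
Let A11 := ulsubmx A.
Let A12 := ursubmx A.
Let A22 := drsubmx A.
Hypotheses (T0 : 0 < T) (S_sym : S^T = S) (dlA : dlsubmx A = 0).

Let Q := integral_mx 0 T (gramian_integrand A S).
Let V := S - expmx (T *: A) *m S *m (expmx (T *: A))^T.

(** The lower blocks of the exponential are zero and the exponential of [t *: A22], so this corner
    of the integrand sees only the same corner of [S]. *)
Lemma drsubmx_gramian :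
  drsubmx Q = integral_mx 0 T (gramian_integrand A22 (drsubmx S)).
Proof.
rewrite drsubmx_integral_mx; congr integral_mx; apply/funext => t.
rewrite /gramian_integrand.
have dl : dlsubmx (t *: A) = 0.
  by rewrite /dlsubmx !linearZ/= -/(dlsubmx A) dlA scaler0.
rewrite -[expmx (t *: A)]submxK dlsubmx_expmx// drsubmx_expmx//.
have -> : drsubmx (t *: A) = t *: A22 by rewrite /drsubmx !linearZ.
rewrite -[S in LHS]submxK tr_block_mx trmx0 !mulmx_block block_mxKdr.
by rewrite !mul0mx mulmx0 !add0r.
Qed.

Lemma gramian_block :
  Q = block_mx (ulsubmx Q) (ursubmx Q) (ursubmx Q)^T (drsubmx Q).
Proof. by rewrite trmx_ursub (trmx_gramian _ _ S_sym) submxK. Qed.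

(** Read off from the equation of the whole Gramian, the symmetry of [Q] supplying its lower left
    block. *)
Let lyapunov_blocks :
  A11 *m ulsubmx Q + A12 *m (ursubmx Q)^T +
    (ulsubmx Q *m A11^T + ursubmx Q *m A12^T) = - ulsubmx V /\
  A11 *m ursubmx Q + A12 *m drsubmx Q + ursubmx Q *m A22^T = - ursubmx V.
Proof.
have lyap : A *m Q + Q *m A^T = - V by exact: gramian_lyapunov.
rewrite gramian_block -[A]submxK -[V]submxK dlA tr_block_mx trmx0 in lyap.
rewrite !mulmx_block !mul0mx !mulmx0 !add0r add_block_mx opp_block_mx in lyap.
by case/eq_block_mx: lyap.
Qed.

Lemma gramian_sylvester :
  A11 *m ursubmx Q + ursubmx Q *m A22^T = - ursubmx V - A12 *m drsubmx Q.
Proof. by case: lyapunov_blocks => _ <-; rewrite addrAC addrK. Qed.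

Lemma gramian_ullyapunov :
  A11 *m ulsubmx Q + ulsubmx Q *m A11^T =
  - ulsubmx V - A12 *m (ursubmx Q)^T - ursubmx Q *m A12^T.
Proof.
by case: lyapunov_blocks => <- _; rewrite addrACA -[RHS]addrA -opprD addrK.
Qed.

End BlockGramian.

Theorem mainTheorem2 (R : realType) (n : nat) (A S : 'M[R]_n) (T : R)
    (hS : sym_psd S) (hT : 0 < T)
    (p m : nat) (hp : p = alg_mult A 0) (hm : m = (n - p)%N)
    (hA : forall lambda mu : R[i],
        complex_eigenvalue A lambda -> complex_eigenvalue A mu ->
        lambda != 0 -> mu != 0 -> lambda + mu != 0) :
  let e : (m + p)%N = n := split_dim hp hm in
  (exists U : 'M[R]_n, zero_splitting e A U) /\
  (exists U : 'M[R]_n, zero_splitting e A U /\ U^T *m U = 1%:M) /\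
  (forall U : 'M[R]_n, zero_splitting e A U ->
    let At := invmx U *m A *m U in
    let A11 := ulsubmx (to_blocks e At) in
    let A12 := ursubmx (to_blocks e At) in
    let A22 := drsubmx (to_blocks e At) in
    let St := invmx U *m S *m (invmx U)^T in
    let S11 := ulsubmx (to_blocks e St) in
    let S12 := ursubmx (to_blocks e St) in
    let S22 := drsubmx (to_blocks e St) in
    let Ft := expmx (T *: At) in
    let Vt := St - Ft *m St *m Ft^T in
    let V11 := ulsubmx (to_blocks e Vt) in
    let V12 := ursubmx (to_blocks e Vt) in
    let V22 := drsubmx (to_blocks e Vt) in
    let Q22 : 'M[R]_p :=
      \sum_(i < p) \sum_(j < p)
        (T ^+ (i + j + 1) / (i`!%:R * j`!%:R * (i + j + 1)%:R)) *:
          (A22 ^+ i *m S22 *m (A22 ^+ j)^T) in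
    let sylvester (Q12 : 'M[R]_(m, p)) :=
      A11 *m Q12 + Q12 *m A22^T = - V12 - A12 *m Q22 in
    let lyapunov (Q12 : 'M[R]_(m, p)) (Q11 : 'M[R]_m) :=
      A11 *m Q11 + Q11 *m A11^T = - V11 - A12 *m Q12^T - Q12 *m A12^T in
    [/\ At = of_blocks e (block_mx A11 A12 0 A22),
        St = of_blocks e (block_mx S11 S12 S12^T S22),
        Vt = of_blocks e (block_mx V11 V12 V12^T V22),
        U *m Ft *m invmx U = expmx (T *: A) &
        (exists! Q12 : 'M[R]_(m, p), sylvester Q12) /\
        (forall Q12 : 'M[R]_(m, p), sylvester Q12 ->
           (exists! Q11 : 'M[R]_m, lyapunov Q12 Q11) /\
           (forall Q11 : 'M[R]_m, lyapunov Q12 Q11 ->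
              U *m of_blocks e (block_mx Q11 Q12 Q12^T Q22) *m U^T =
              integral_mx 0 T
                (fun tau => expmx (tau *: A) *m S *m expmx (tau *: A^T))))]).
Proof.
move=> e; have [U0 zU0 UU0] := zero_splitting_exists e hp.
split; first by exists U0.
split; first by exists U0.
move=> U zU.
have hA11 z : complex_eigenvalue (ulsubmx (to_blocks e (invmx U *m A *m U))) z ->
    complex_eigenvalue A z.
  exact: zero_splitting_eigenvalue zU.
move: hS => [S_sym _].
(* Once opaque, [e] can be eliminated like a variable and all casts become trivial. *)
clearbody e; clear U0 zU0 UU0 hp hm.
case: n / e A S hA U zU hA11 S_sym => A S hA U zU hA11 S_sym At A11 A12 A22 St.
move=> S11 S12 S22 Ft Vt V11 V12 V22 Q22 sylvester lyapunov.
have [uU dl A11e A22e] := zU.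
have symSt : St^T = St by rewrite /St !trmx_mul trmxK S_sym mulmxA.
have symVt : Vt^T = Vt.
  by rewrite /Vt raddfB/= symSt (trmx_mul (Ft *m St)) trmxK (trmx_mul Ft) symSt mulmxA.
have FtE : U *m Ft *m invmx U = expmx (T *: A).
  rewrite /Ft expmx_conj// -scalemxAr -scalemxAl /At !mulmxA mulmxV// mul1mx.
  by rewrite -mulmxA mulmxV// mulmx1.
split=> //.
- by rewrite -{1}[At]submxK; congr block_mx.
- by rewrite -{1}[St]submxK; congr block_mx; rewrite /S12 trmx_ursub symSt.
- by rewrite -{1}[Vt]submxK; congr block_mx; rewrite /V12 trmx_ursub symVt.
have nilp : A22 ^+ p = 0 by exact/nilpotent_char_poly/char_poly_nilpotent.
(* The Gramian in the new coordinates: its blocks solve both equations, and uniqueness identifies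
   any other solutions with them. *)
pose Q := integral_mx 0 T (gramian_integrand At St).
have Q22E : drsubmx Q = Q22.
  by rewrite drsubmx_gramian// (gramian_nilpotent _ hT nilp).
have sQ : sylvester (ursubmx Q).
  by rewrite /sylvester -Q22E; exact: gramian_sylvester.
have lQ : lyapunov (ursubmx Q) (ulsubmx Q) by exact: gramian_ullyapunov.
have uniq12 : exists! Q12, sylvester Q12.
  (* A common eigenvalue [z] of [A11] and [- A22^T] makes [- z] an eigenvalue of [A22], so [z = 0],
     which [A11] excludes. *)
  apply/sylvester_solvable/coprime_char_poly => z zA11.
  move=> /complex_eigenvalueN; rewrite complex_eigenvalue_tr => /A22e/eqP.
  by rewrite oppr_eq0 => /eqP z0; have := A11e z zA11; rewrite z0 eqxx.
have uniq11 Q12 : exists! Q11, lyapunov Q12 Q11.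
  (* A common eigenvalue [z] of [A11] and [- A11^T] makes [z] and [- z] nonzero eigenvalues of [A]
     with sum zero. *)
  apply/sylvester_solvable/coprime_char_poly => z zA11.
  move=> /complex_eigenvalueN; rewrite complex_eigenvalue_tr => zA11'.
  have := hA _ _ (hA11 _ zA11) (hA11 _ zA11') (A11e _ zA11) (A11e _ zA11').
  by rewrite subrr eqxx.
split=> // Q12 s12; split=> // Q11 l11.
have Q12E : Q12 = ursubmx Q.
  by have [X [_ uX]] := uniq12; rewrite -(uX _ s12) (uX _ sQ).
have Q11E : Q11 = ulsubmx Q.
  rewrite Q12E in l11.
  by have [X [_ uX]] := uniq11 (ursubmx Q); rewrite -(uX _ l11) (uX _ lQ).
rewrite Q11E Q12E -Q22E -[of_blocks _ _]/(block_mx _ _ _ _) -gramian_block//.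
(* Congruence by [U] is linear, so it moves under the integral and undoes the change of coordinates
   there. *)
pose phi : {linear 'M[R]_(m + p) -> 'M[R]_(m + p)} := mulmxr U^T \o mulmx U.
rewrite -[LHS]/(phi Q) -linear_integral_mx; last exact: continuous_gramian_integrand.
congr integral_mx; apply/funext => t /=; rewrite /gramian_integrand.
have -> : t *: At = invmx U *m (t *: A) *m invmx (invmx U).
  by rewrite invmxK -scalemxAr -scalemxAl.
rewrite -expmx_conj ?unitmx_inv// invmxK !trmx_mul /St !mulmxA mulmxV// mul1mx.
rewrite -!mulmxA (mulmxA U) mulmxV// mul1mx; congr (_ *m (_ *m _)).
have UVt : (invmx U)^T *m U^T = 1%:M by rewrite -trmx_mul mulmxV// trmx1.
by rewrite UVt mulmx1 mulmxA UVt mul1mx trmx_expmx linearZ.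
Qed.
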